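(* Let $\mathbf{D}$ be the finitary distribution monad and $\mathbf{M}$ the maybe monad on the category of sets. Normalization $n=(-)^{\circ}\colon\mathbf{D}\mathbf{M}X\to\mathbf{M}\mathbf{D}X$ and the subdistributional inclusion $m=(-)^{\bullet}\colon\mathbf{M}\mathbf{D}X\to\mathbf{D}\mathbf{M}X$ form a sesquilaw $(\mathbf{M},\mathbf{D},m,n)$ of the distribution monad $\mathbf{D}$ over the maybe monad $\mathbf{M}$.
   Context: Distribution monad: $\mathbf{D}X$ is the set of finite formal sums $\sum_i\lambda_i|x_i\rangle$ with $x_i\in X$, $\lambda_i>0$, $\sum_i\lambda_i=1$; unit $\eta^{\mathbf D}(x)=|x\rangle$; multiplication $\mu^{\mathbf D}(\sum_i\lambda_i|\sum_j\mu_{ij}|x_{ij}\rangle\rangle)=\sum_{i,j}\lambda_i\mu_{ij}|x_{ij}\rangle$. Maybe monad: $\mathbf{M}X=X+\{\bot\}$, with unit the inclusion and multiplication $\mathbf{M}\mathbf{M}X=X+\{\bot_1\}+\{\bot_2\}\to \mathbf{M}X$ sending both extra points to $\bot$. An element of $\mathbf{D}\mathbf{M}X$ is identified with a subdistribution, i.e. a finite formal sum $\sum_i\lambda_i|x_i\rangle$ over $X$ with $\lambda_i>0$ and $\sum_i\lambda_i\le 1$ (the missing mass is the coefficient of $\bot$). The zero formal sum $0$ stands for $|\bot\rangle\in\mathbf{D}\mathbf{M}X$ and also for $\bot\in\mathbf{M}\mathbf{D}X$. Normalization: $(\sum_i\lambda_i|x_i\rangle)^\circ=\sum_i\frac{\lambda_i}{\sum_k\lambda_k}|x_i\rangle$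 if $\sum_k\lambda_k\neq0$, and $(0)^\circ=0$. Subdistributional inclusion: $(\bot)^\bullet=0$ and $(\sum_i\lambda_i|x_i\rangle)^\bullet=\sum_i\lambda_i|x_i\rangle$. For monads $(S,\mu^S,\eta^S)$ and $(T,\mu^T,\eta^T)$ on the same category: A distributive law of $S$ over $T$ is a natural transformation $m_X\colon STX\to TSX$ with $m_X\circ\mu^S_{TX}=T(\mu^S_X)\circ m_{SX}\circ S(m_X)$; $m_X\circ\eta^S_{TX}=T(\eta^S_X)$; $m_X\circ S(\mu^T_X)=\mu^T_{SX}\circ T(m_X)\circ m_{TX}$; $m_X\circ S(\eta^T_X)=\eta^T_{SX}$. An almost-distributive law of $T$ over $S$ is a natural transformation $n_X\colon TSX\to STX$ with $n_X\circ T(\mu^S_X)=\mu^S_{TX}\circ S(n_X)\circ n_{SX}$; $n_X\circ\eta^T_{SX}=S(\eta^T_X)$; $n_X\circ T(\eta^S_X)=\eta^S_{TX}$. A sesquilaw $(S,T,m,n)$ of $T$ over $S$ consists of a distributive law $m\colon ST\to TS$ and an almost-distributive law $n\colon TS\to ST$ such that (1) $n_X\circ\mu^T_{SX}\circ T(m_X)=S(\mu^T_X)\circ n_{TX}$ as maps $TSTX\to STX$, and (2) $n_X\circ m_X=\mathrm{id}_{STX}$. *)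

(* Defs.v *)
From mathcomp Require Import all_boot all_order all_algebra finmap.
From mathcomp Require Import boolp classical_sets functions cardinality fsbigop.
From mathcomp Require Import reals.

Set Implicit Arguments.
Unset Strict Implicit.
Unset Printing Implicit Defensive.

Import Order.TTheory GRing.Theory Num.Theory.

Local Open Scope classical_set_scope.
Local Open Scope ring_scope.

(* The category of sets: objects are types, maps are functions, and two maps
   are equal when they agree pointwise. *)

Record monad := Monad {
  mobj :> Type -> Type;
  fmap : forall X Y : Type, (X -> Y) -> mobj X -> mobj Y;
  munit : forall X : Type, X -> mobj X;
  mmul : forall X : Type, mobj (mobj X) -> mobj X;
  fmap_id : forall X : Type, fmap (@id X) =1 id;
  fmap_comp : forall (X Y Z : Type) (g : Y -> Z) (f : X -> Y),
    fmap (g \o f) =1 fmap g \o fmap f;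
  munit_nat : forall (X Y : Type) (f : X -> Y),
    @munit Y \o f =1 fmap f \o @munit X;
  mmul_nat : forall (X Y : Type) (f : X -> Y),
    @mmul Y \o fmap (fmap f) =1 fmap f \o @mmul X;
  mmul_unitl : forall X : Type, @mmul X \o @munit (mobj X) =1 id;
  mmul_unitr : forall X : Type, @mmul X \o fmap (@munit X) =1 id;
  mmulA : forall X : Type,
    @mmul X \o @mmul (mobj X) =1 @mmul X \o fmap (@mmul X)
}.

Arguments fmap m {X Y} f.
Arguments munit : clear implicits.
Arguments mmul : clear implicits.

Section Laws.
Variables S T : monad.

Record distributive_law (m : forall X : Type, S (T X) -> T (S X)) : Prop :=
  DistributiveLaw {
  distl_nat : forall (X Y : Type) (f : X -> Y),
    m Y \o fmap S (fmap T f) =1 fmap T (fmap S f) \o m X;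
  distl_mulS : forall X : Type,
    m X \o mmul S (T X) =1 fmap T (mmul S X) \o m (S X) \o fmap S (m X);
  distl_unitS : forall X : Type,
    m X \o munit S (T X) =1 fmap T (munit S X);
  distl_mulT : forall X : Type,
    m X \o fmap S (mmul T X) =1 mmul T (S X) \o fmap T (m X) \o m (T X);
  distl_unitT : forall X : Type,
    m X \o fmap S (munit T X) =1 munit T (S X)
}.

(* an almost-distributive law of T over S; compatibility with mmul T is not
   required *)
Record almost_distributive_law (n : forall X : Type, T (S X) -> S (T X)) :
  Prop := AlmostDistributiveLaw {
  adistl_nat : forall (X Y : Type) (f : X -> Y),
    n Y \o fmap T (fmap S f) =1 fmap S (fmap T f) \o n X;
  adistl_mulS : forall X : Type,
    n X \o fmap T (mmul S X) =1 mmul S (T X) \o fmap S (n X) \o n (S X);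
  adistl_unitT : forall X : Type,
    n X \o munit T (S X) =1 fmap S (munit T X);
  adistl_unitS : forall X : Type,
    n X \o fmap T (munit S X) =1 munit S (T X)
}.

Record sesquilaw (m : forall X : Type, S (T X) -> T (S X))
    (n : forall X : Type, T (S X) -> S (T X)) : Prop := Sesquilaw {
  sesqui_dist : distributive_law m;
  sesqui_almost : almost_distributive_law n;
  sesqui_mul : forall X : Type,
    n X \o mmul T (S X) \o fmap T (m X) =1 fmap S (mmul T X) \o n (T X);
  sesqui_section : forall X : Type, n X \o m X =1 id
}.

End Laws.

(* The added point of M X = X + {bot} is None. *)

Definition maybe_mul (X : Type) (o : option (option X)) : option X :=
  if o is Some x then x else None.

Definition maybe_monad : monad.
Proof.
apply: (@Monad option (fun X Y => @omap X Y) (@Some) maybe_mul) => //.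
- by move=> X [].
- by move=> X Y Z g f [].
- by move=> X Y f [].
- by move=> X [].
- by move=> X [].
Defined.

Section Dist.
Variable R : realType.

(* {classic X} is X equipped with a choiceType structure; the sum of a
   function without finite support is 0. *)
Definition fsum (X : Type) (A : set X) (f : X -> R) : R :=
  \sum_(x \in (A : set {classic X})) f x.

(* The formal sum \sum_i l_i |x_i> is represented by its coefficient function,
   mapping x to the sum of the l_i with x_i = x; it is supported by the x_i. *)
Record dist (X : Type) := Dist {
  dcoef :> X -> R;
  dcoef_ge0 : forall x, 0 <= dcoef x;
  dcoef_fin : finite_set [set x | dcoef x != 0];
  dcoef_sum : fsum setT dcoef = 1
}.

Lemma dist_ext X (p q : dist X) : p =1 q -> p = q.
Proof.
case: p q => [p p0 pf p1] [q q0 qf q1] /= /funext pq.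
by move: pq p0 pf p1 q0 qf q1 => -> *; congr Dist; exact: Prop_irrelevance.
Qed.

Definition dsupp X (p : dist X) : seq {classic X} :=
  fset_set ([set x | p x != 0] : set {classic X}).

Lemma dsuppP X (p : dist X) x : p x != 0 -> (x : {classic X}) \in dsupp p.
Proof.
by move=> px; rewrite /dsupp in_fset_set; [rewrite inE | exact: dcoef_fin].
Qed.

Lemma dsupp_uniq X (p : dist X) : uniq (dsupp p).
Proof. exact: fset_uniq. Qed.

Lemma fsumE X (s : seq {classic X}) (f : X -> R) : uniq s ->
  (forall x, f x != 0 -> (x : {classic X}) \in s) ->
  fsum setT f = \sum_(x <- s) f x.
Proof.
move=> us fs; rewrite /fsum (fsbigE s) //.
  by apply: eq_bigl => x; rewrite in_setT.
move=> x _ xs; apply/eqP; apply: contraNT xs; exact: fs.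
Qed.

Lemma fsum_ge0 X (A : set X) (f : X -> R) :
  (forall x, 0 <= f x) -> 0 <= fsum A f.
Proof. by move=> f0; apply: fsumr_ge0. Qed.

Lemma finite_seqP X (f : X -> R) (s : seq {classic X}) :
  (forall x, f x != 0 -> (x : {classic X}) \in s) ->
  finite_set [set x | f x != 0].
Proof.
move=> fs; apply: (@sub_finite_set _ _ [set` s]); first by move=> x /fs.
exact: finite_seq.
Qed.

(* expectation of g under p *)
Definition expect X (p : dist X) (g : X -> R) : R :=
  fsum setT (fun x => p x * g x).

Lemma expectE X (p : dist X) (g : X -> R) :
  expect p g = \sum_(x <- dsupp p) p x * g x.
Proof.
apply: fsumE; first exact: dsupp_uniq.
by move=> x pg; apply: dsuppP; apply: contraNneq pg => ->; rewrite mul0r.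
Qed.

Lemma expect1 X (p : dist X) : expect p (fun=> 1) = 1.
Proof.
rewrite -[RHS](dcoef_sum p) /expect; congr fsum.
by apply/funext => x; rewrite mulr1.
Qed.

Definition ind X (x y : X) : R := if `[< x = y >] then 1 else 0.

Lemma ind_supp X (x y : X) :
  ind x y != 0 -> (y : {classic X}) \in [:: x : {classic X}].
Proof.
rewrite inE /ind; case: asboolP => [-> _|_ /eqP //]; exact: eqxx.
Qed.

Lemma fsum_ind X (x : X) (g : X -> R) : fsum setT (fun y => ind x y * g y) = g x.
Proof.
rewrite (@fsumE _ [:: x : {classic X}]) //.
  by rewrite big_seq1 /ind asboolT // mul1r.
by move=> y h; apply: ind_supp; apply: contraNneq h => ->; rewrite mul0r.
Qed.

Lemma expect_ind X (p : dist X) (y : X) : expect p (fun x => ind x y) = p y.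
Proof.
rewrite -[RHS](fsum_ind y (p : X -> R)) /expect; congr fsum; apply/funext => x.
rewrite mulrC /ind; congr (_ * _); congr (if _ then _ else _).
by apply/asbool_equiv_eq; split.
Qed.

Lemma dirac_ge0 X (x y : X) : 0 <= ind x y.
Proof. by rewrite /ind; case: asboolP. Qed.

Lemma dirac_sum X (x : X) : fsum setT (ind x) = 1.
Proof.
rewrite -[RHS](fsum_ind x (fun=> 1)); congr fsum.
by apply/funext => y; rewrite mulr1.
Qed.

Definition dirac X (x : X) : dist X :=
  Dist (dirac_ge0 x) (finite_seqP (@ind_supp X x)) (dirac_sum x).

Section Bind.
Variables (X Y : Type) (p : dist X) (k : X -> dist Y).

Let w (y : Y) : R := expect p (fun x => k x y).

Let wsupp : seq {classic Y} :=
  undup (flatten [seq dsupp (k x) | x : {classic X} <- dsupp p]).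

Lemma bind_ge0 y : 0 <= w y.
Proof. by apply: fsum_ge0 => x; rewrite mulr_ge0 ?dcoef_ge0. Qed.

Lemma bind_supp y : w y != 0 -> (y : {classic Y}) \in wsupp.
Proof.
rewrite mem_undup => wy; apply/(@flatten_mapP {classic X}); apply: contrapT => nex.
case/eqP: wy; rewrite /w expectE big1_seq // => x /andP[_ xp].
have [->|ky] := eqVneq (k x y) 0; first by rewrite mulr0.
by case: nex; exists x => //; apply: dsuppP.
Qed.

Lemma bind_fsum (g : Y -> R) :
  fsum setT (fun y => w y * g y) = expect p (fun x => expect (k x) g).
Proof.
rewrite (@fsumE _ wsupp) ?undup_uniq //; last first.
  by move=> y h; apply: bind_supp; apply: contraNneq h => ->; rewrite mul0r.
under eq_bigr do rewrite /w expectE mulr_suml.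
rewrite exchange_big expectE; apply: eq_big_seq => x xp.
under eq_bigr do rewrite -mulrA.
rewrite -mulr_sumr; congr (_ * _); symmetry; apply: fsumE.
  exact: undup_uniq.
move=> y h; rewrite mem_undup; apply/(@flatten_mapP {classic X}); exists x => //.
by apply: dsuppP; apply: contraNneq h => ->; rewrite mul0r.
Qed.

Lemma bind_sum : fsum setT w = 1.
Proof.
have := bind_fsum (fun=> 1).
have -> : (fun x => expect (k x) (fun=> 1)) = fun=> 1.
  by apply/funext => x; exact: expect1.
rewrite expect1 => <-; congr fsum; apply/funext => y; by rewrite mulr1.
Qed.

Definition bind : dist Y := Dist bind_ge0 (finite_seqP bind_supp) bind_sum.

End Bind.

Lemma expect_bind X Y (p : dist X) (k : X -> dist Y) g :
  expect (bind p k) g = expect p (fun x => expect (k x) g).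
Proof. exact: bind_fsum. Qed.

Lemma expect_dirac X (x : X) g : expect (dirac x) g = g x.
Proof. exact: fsum_ind. Qed.

(* \sum_i l_i |x_i> is mapped to \sum_i l_i |f x_i>, whose coefficient at y
   collects the l_i with f x_i = y. *)
Definition dmap_coef X Y (f : X -> Y) (p : dist X) (y : Y) : R :=
  fsum (f @^-1` [set y]) p.

Lemma dmap_coefE X Y (f : X -> Y) (p : dist X) :
  dmap_coef f p = bind p (fun x => dirac (f x)).
Proof.
apply/funext => y; rewrite /dmap_coef /fsum fsbig_mkcond /=.
rewrite /expect /fsum; apply: eq_fsbigr => x _; rewrite /patch /ind.
by case: asboolP => fxy; [rewrite mem_set // mulr1|rewrite memNset // mulr0].
Qed.

Lemma dmap_ge0 X Y (f : X -> Y) p y : 0 <= dmap_coef f p y.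
Proof. by rewrite dmap_coefE dcoef_ge0. Qed.

Lemma dmap_fin X Y (f : X -> Y) p : finite_set [set y | dmap_coef f p y != 0].
Proof. by rewrite dmap_coefE; exact: dcoef_fin. Qed.

Lemma dmap_sum X Y (f : X -> Y) p : fsum setT (dmap_coef f p) = 1.
Proof. by rewrite dmap_coefE dcoef_sum. Qed.

Definition dmap X Y (f : X -> Y) (p : dist X) : dist Y :=
  Dist (dmap_ge0 f p) (dmap_fin f p) (dmap_sum f p).

Lemma dmapE X Y (f : X -> Y) p : dmap f p = bind p (fun x => dirac (f x)).
Proof. by apply: dist_ext => y /=; rewrite dmap_coefE. Qed.

(* \sum_i l_i |\sum_j m_ij |x_ij>> is mapped to \sum_ij (l_i m_ij) |x_ij>. *)
Definition dmul_coef X (P : dist (dist X)) (x : X) : R :=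
  fsum setT (fun p : dist X => P p * p x).

Lemma dmul_ge0 X (P : dist (dist X)) x : 0 <= dmul_coef P x.
Proof. exact: (bind_ge0 P id). Qed.

Lemma dmul_fin X (P : dist (dist X)) : finite_set [set x | dmul_coef P x != 0].
Proof. exact: (dcoef_fin (bind P id)). Qed.

Lemma dmul_sum X (P : dist (dist X)) : fsum setT (dmul_coef P) = 1.
Proof. exact: (dcoef_sum (bind P id)). Qed.

Definition dmul X (P : dist (dist X)) : dist X :=
  Dist (dmul_ge0 P) (dmul_fin P) (dmul_sum P).

Lemma dmulE X (P : dist (dist X)) : dmul P = bind P id.
Proof. exact: dist_ext. Qed.

Lemma expect_ext X (p q : dist X) : expect p =1 expect q -> p = q.
Proof. by move=> pq; apply: dist_ext => x; rewrite -!expect_ind pq. Qed.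

Lemma expect_dmap X Y (f : X -> Y) p g : expect (dmap f p) g = expect p (g \o f).
Proof.
rewrite dmapE expect_bind; congr expect; apply/funext => x.
exact: expect_dirac.
Qed.

Lemma expect_dmul X (P : dist (dist X)) g :
  expect (dmul P) g = expect P (fun p => expect p g).
Proof. by rewrite dmulE expect_bind. Qed.

Definition dist_monad : monad.
Proof.
apply: (@Monad dist dmap dirac dmul).
- by move=> X p; apply: expect_ext => g; rewrite expect_dmap.
- by move=> X Y Z g f p; apply: expect_ext => h /=; rewrite !expect_dmap.
- move=> X Y f x; apply: expect_ext => h /=.
  by rewrite expect_dmap !expect_dirac.
- move=> X Y f P; apply: expect_ext => h /=.
  rewrite !(expect_dmap, expect_dmul); congr expect; apply/funext => p /=.
  exact: expect_dmap.
- by move=> X p; apply: expect_ext => h /=; rewrite expect_dmul expect_dirac.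
- move=> X p; apply: expect_ext => h /=.
  rewrite expect_dmul expect_dmap; congr expect; apply/funext => x /=.
  exact: expect_dirac.
- move=> X P; apply: expect_ext => h /=.
  rewrite !(expect_dmap, expect_dmul); congr expect; apply/funext => p /=.
  by rewrite expect_dmul.
Defined.

(* p : dist (option X) is identified with the subdistribution
   \sum_x p (Some x) |x>; its coefficient p None is the missing mass. *)
Section Normalization.
Variables (X : Type) (p : dist (option X)).

Definition mass : R := fsum setT (fun x : X => p (Some x)).

Definition normalized_coef (x : X) : R := p (Some x) / mass.

Lemma normalized_ge0 x : 0 <= normalized_coef x.
Proof.
by rewrite divr_ge0 ?dcoef_ge0 //; apply: fsum_ge0 => y; exact: dcoef_ge0.
Qed.

Lemma normalized_fin : finite_set [set x | normalized_coef x != 0].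
Proof.
apply: (@sub_finite_set _ _ (Some @^-1` [set o | p o != 0])).
  by move=> x; apply: contraNneq; rewrite /normalized_coef => ->; rewrite mul0r.
apply: finite_preimage; last exact: dcoef_fin.
by move=> x y _ _ [].
Qed.

Lemma normalized_sum : mass <> 0 -> fsum setT normalized_coef = 1.
Proof.
move=> /eqP m0; rewrite -[RHS](divff m0) {2}/mass /fsum mulr_fsuml //.
Qed.

Definition normalized (m0 : mass <> 0) : dist X :=
  Dist normalized_ge0 normalized_fin (normalized_sum m0).

Definition normalize : option (dist X) :=
  match mass =P 0 with
  | ReflectT _ => None
  | ReflectF m0 => Some (normalized m0)
  end.

End Normalization.

Section Inclusion.
Variables (X : Type) (q : dist X).

Definition incl_coef (o : option X) : R := if o is Some x then q x else 0.

Lemma incl_coefE : incl_coef = dmap Some q.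
Proof.
apply/funext => -[x|] /=; rewrite /dmap_coef.
  rewrite (_ : _ @^-1` _ = [set x]); first by rewrite /fsum fsbig_set1.
  by apply/seteqP; split => [y [->]|y ->].
rewrite (_ : _ @^-1` _ = set0); first by rewrite /fsum fsbig_set0.
by apply/seteqP; split.
Qed.

Lemma incl_ge0 o : 0 <= incl_coef o.
Proof. by rewrite incl_coefE dcoef_ge0. Qed.

Lemma incl_fin : finite_set [set o | incl_coef o != 0].
Proof. by rewrite incl_coefE; exact: dcoef_fin. Qed.

Lemma incl_sum : fsum setT incl_coef = 1.
Proof. by rewrite incl_coefE dcoef_sum. Qed.

End Inclusion.

(* The zero subdistribution is dirac None. *)
Definition subdist_incl X (o : option (dist X)) : dist (option X) :=
  if o is Some q then Dist (incl_ge0 q) (incl_fin q) (incl_sum q)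
  else dirac None.

End Dist.

Arguments normalize R X p : clear implicits.
Arguments subdist_incl R X o : clear implicits.

(* Main.v *)
Require Import Defs.
From mathcomp Require Import all_boot all_order all_algebra.
From mathcomp Require Import boolp classical_sets fsbigop.
From mathcomp Require Import reals.

(** A distribution is determined by the expectations it assigns to all
    real-valued functions, and each operation of the distribution monad acts on
    expectations by a simple substitution.  The inclusion of subdistributions
    acts in the same way ([expect_subdist_incl]), so the distributive law axioms
    reduce to a case distinction on the added point.

    Normalization divides by the mass, which is not linear, and this is what
    has to be controlled.  A subdistribution [p] acts on functions on [X] by
    [subexpect p], where the added point contributes nothing.  The normal form
    of [p] is the only [o] such that [subexpect p] is a nonzero multiple of the
    expectation under [o], where the absent distribution stands for the zero
    functional ([proportional_normalize], [proportional_unique]).  Hence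
    [normalize] can be computed by exhibiting any such [o], without division by
    masses.

    Compatibility with the multiplication of the maybe monad holds because
    discarding mass in two steps multiplies two factors, and nonzero factors
    have a nonzero product.  Naturality and the axiom linking normalization to
    the multiplication of distributions are two cases of one fact
    ([normalize_bind]): pushing a subdistribution forward along a kernel of full
    distributions preserves its mass, hence commutes with normalization.  In the
    second case the kernel is the identity, since the subdistributions obtained
    by inclusion have mass one or zero.  A kernel that loses mass by an amount
    depending on the point would break this, which is why normalization is
    compatible with the multiplication of distributions only in this
    restricted form. *)

Set Implicit Arguments.
Unset Strict Implicit.
Unset Printing Implicit Defensive.

Import Order.TTheory GRing.Theory Num.Theory.

Local Open Scope classical_set_scope.
Local Open Scope ring_scope.

Section Normalization.
Variable R : realType.

Lemma fsum_Some (X : Type) (f : option X -> R) :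
  f None = 0 -> fsum setT (f \o Some) = fsum setT f.
Proof.
move=> f0; rewrite /fsum.
rewrite -(fsbig_widen (Some @` [set: X] : set {classic option X})) //=.
  rewrite (@fsbig_image _ _ _ {classic X} {classic option X}) //.
  by move=> x y _ _ [].
by move=> [x|] [_ /= nx] //; case: nx; exists x.
Qed.

Definition subexpect (X : Type) (p : dist R (option X)) (g : X -> R) : R :=
  expect p (oapp g 0).

Lemma subexpectE (X : Type) (p : dist R (option X)) (g : X -> R) :
  subexpect p g = fsum setT (fun x => p (Some x) * g x).
Proof. by rewrite /subexpect /expect -fsum_Some //= mulr0. Qed.

Lemma subexpect1 (X : Type) (p : dist R (option X)) :
  subexpect p (fun=> 1) = mass p.
Proof.
by rewrite subexpectE /mass; congr fsum; apply/funext => x; rewrite mulr1.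
Qed.

Lemma mass_eq0 (X : Type) (p : dist R (option X)) :
  mass p = 0 -> forall x, p (Some x) = 0.
Proof.
rewrite -subexpect1 /subexpect expectE => /eqP.
rewrite psumr_eq0 => [/allP p0 x|o _]; last first.
  by rewrite mulr_ge0 ?dcoef_ge0 //; case: o => //= x; exact: ler01.
apply/eqP; apply: contrapT => /negP px.
by have /= := p0 _ (dsuppP px); rewrite mulr1 (negbTE px).
Qed.

(** The factor [c] is existentially quantified instead of being set to the mass
    of [p]: evaluation at the constant function 1 forces that value, and leaving
    it free spares its computation. *)
Definition proportional (X : Type) (p : dist R (option X))
    (o : option (dist R X)) : Prop :=
  if o is Some q then
    exists2 c, c != 0 & forall g, subexpect p g = c * expect q g
  else forall g, subexpect p g = 0.

Lemma proportional_normalize (X : Type) (p : dist R (option X)) :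
  proportional p (normalize R X p).
Proof.
rewrite /normalize; case: eqP => [m0 g|m0] /=.
  rewrite subexpectE /fsum fsbig1 // => x _.
  by rewrite mass_eq0 // mul0r.
exists (mass p); first exact/eqP.
move=> g; rewrite subexpectE /expect /= /fsum mulr_fsumr.
apply: eq_fsbigr => x _.
by rewrite mulrA; congr (_ * _); rewrite mulrC divfK //; exact/eqP.
Qed.

(** Every distribution has total mass 1, so the constant function 1 recovers the
    factor: it tells the zero functional from the others, and two distributions
    proportional to the same functional have equal factors. *)
Lemma proportional_unique (X : Type) (p : dist R (option X)) o o' :
  proportional p o -> proportional p o' -> o = o'.
Proof.
have factor q c : (forall g, subexpect p g = c * expect q g) ->
    subexpect p (fun=> 1) = c by move=> ->; rewrite expect1 mulr1.
case: o o' => [q|] [q'|] //=.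
- move=> [c c0 pq] [c' _ pq']; congr Some; apply: expect_ext => g.
  by apply: (mulfI c0); rewrite -pq -(factor _ _ pq) (factor _ _ pq').
- by move=> [c /eqP c0 pq] p0; case: c0; rewrite -(factor _ _ pq).
- by move=> p0 [c /eqP c0 pq]; case: c0; rewrite -(factor _ _ pq).
Qed.

Lemma normalize_eq (X : Type) (p : dist R (option X)) o :
  proportional p o -> normalize R X p = o.
Proof. exact/proportional_unique/proportional_normalize. Qed.

Lemma normalize_full (X : Type) (p : dist R (option X)) (q : dist R X) :
  (forall g, subexpect p g = expect q g) -> normalize R X p = Some q.
Proof.
move=> pq; apply: normalize_eq; exists 1; first exact: oner_neq0.
by move=> g; rewrite mul1r.
Qed.

(** The hypotheses say that [p'] and [F q] arise from [p] and [q] by the kernel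
    [k]; the values of [k] being full distributions, the factor that relates [p]
    to its normal form also relates [p'] to the image of that normal form. *)
Lemma normalize_bind (X Y : Type) (p : dist R (option X))
    (p' : dist R (option Y)) (k : X -> dist R Y) (F : dist R X -> dist R Y) :
  (forall g, subexpect p' g = subexpect p (fun x => expect (k x) g)) ->
  (forall q g, expect (F q) g = expect q (fun x => expect (k x) g)) ->
  normalize R Y p' = omap F (normalize R X p).
Proof.
move=> pp' Fk; apply: normalize_eq; have := proportional_normalize p.
case: normalize => [q [c c0 pq]|p0] /= => [|g]; last by rewrite pp' p0.
by exists c => // g; rewrite pp' Fk pq.
Qed.

Local Arguments subdist_incl : simpl never.

Lemma expect_subdist_incl (X : Type) (o : option (dist R X)) g :
  expect (subdist_incl R X o) g =
  oapp (fun q => expect q (g \o Some)) (g None) o.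
Proof.
case: o => [q|]; last exact: expect_dirac.
rewrite /subdist_incl /= -expect_dmap; congr expect; apply: dist_ext => o /=.
by rewrite incl_coefE.
Qed.

Lemma subexpect_subdist_incl (X : Type) (o : option (dist R X)) g :
  subexpect (subdist_incl R X o) g = oapp (fun q => expect q g) 0 o.
Proof. exact: expect_subdist_incl. Qed.

Lemma subdist_incl_distributive :
  @distributive_law maybe_monad (dist_monad R) (subdist_incl R).
Proof.
split=> /=.
- move=> X Y f o; apply: expect_ext => g /=.
  rewrite expect_dmap !expect_subdist_incl.
  by case: o => //= p; rewrite expect_dmap.
- move=> X [[p|]|]; apply: expect_ext => g /=;
    by rewrite expect_dmap !expect_subdist_incl /= ?expect_subdist_incl.
- move=> X p; apply: expect_ext => g /=.
  by rewrite expect_subdist_incl expect_dmap.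
- move=> X o; apply: expect_ext => g /=.
  rewrite expect_dmul expect_dmap !expect_subdist_incl.
  case: o => [P|] /=; last by rewrite expect_dirac.
  rewrite expect_dmul; congr expect; apply/funext => p /=.
  by rewrite expect_subdist_incl.
- move=> X o; apply: expect_ext => g /=.
  rewrite expect_subdist_incl expect_dirac.
  by case: o => //= x; rewrite expect_dirac.
Qed.

Lemma normalize_almost_distributive :
  @almost_distributive_law maybe_monad (dist_monad R) (normalize R).
Proof.
split=> /=.
- move=> X Y f p /=.
  apply: (normalize_bind (k := fun x => dirac R (f x))) => [g|q g].
    rewrite /subexpect expect_dmap; congr expect.
    by apply/funext => -[x|] //=; rewrite expect_dirac.
  rewrite expect_dmap; congr expect.
  by apply/funext => x /=; rewrite expect_dirac.
- move=> X p /=; apply: normalize_eq.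
  (* Both added points count for nothing, so merging them first or discarding
     them one after the other yields the same functional. *)
  have E g : subexpect (dmap (@maybe_mul X) p) g = subexpect p (oapp g 0).
    by rewrite /subexpect expect_dmap; congr expect; apply/funext => -[].
  have := proportional_normalize p.
  case: normalize => [q [c c0 pq]|p0] /= => [|g]; last by rewrite E p0.
  have := proportional_normalize q.
  case: normalize => [r [d d0 qr]|q0] /= => [|g]; last first.
    by rewrite E pq -/(subexpect q g) q0 mulr0.
  exists (c * d); first by rewrite mulf_neq0.
  by move=> g; rewrite E pq -mulrA -qr.
- move=> X [x|] /=.
    by apply: normalize_full => g; rewrite /subexpect !expect_dirac.
  by apply: normalize_eq => g; rewrite /subexpect expect_dirac.
- by move=> X p; apply: normalize_full => g; rewrite /subexpect expect_dmap.
Qed.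

End Normalization.

Theorem theorem3p4 (R : realType) :
  @sesquilaw maybe_monad (dist_monad R) (subdist_incl R) (normalize R).
Proof.
split=> [||X P|X [q|]] /=.
- exact: subdist_incl_distributive.
- exact: normalize_almost_distributive.
- (* The outer distribution ranges over distributions, which serve as their own
     kernel; the added point is sent to the zero subdistribution. *)
  apply: (normalize_bind (k := id)) => [g|Q g]; last exact: expect_dmul.
  rewrite /subexpect expect_dmul expect_dmap; congr expect.
  by apply/funext => o; exact: subexpect_subdist_incl.
- by apply: normalize_full => g; rewrite (subexpect_subdist_incl (Some q)).
- by apply: normalize_eq => g; rewrite (subexpect_subdist_incl None).
Qed.
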